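(* Let $X$ be a Noetherian space and $\alpha$ be a bound. Let $\leq^{\mathrm{top}}_*$ be the specialization preordering of $X^{<\alpha}$ with the regular subword topology. \begin{enumerate} \item Every $w\in X^{<\alpha}$ can be written as a finite concatenation $w_1\cdots w_n$ of topologically indecomposable words, and then $\eta_{X^{<\alpha}}(w)=\overline w=\overline{w_1}\cdots\overline{w_n}$, and $\overline{w_i}=(\mathrm{supp}\,w_i)^{<|w_i|+1}$ for every $i$ with $1\le i\le n$. \item For all transfinite words $w=w_1\cdots w_m$ and $w'=w'_1\cdots w'_n$ in $X^{<\alpha}$ written as finite concatenations of topologically indecomposable words, $w\leq^{\mathrm{top}}_* w'$ if and only if there are indices $0=i_0\le i_1\le\cdots\le i_{n-1}\le i_n=m$ such that for every $j$ with $1\le j\le n$, $\bigcup_{i=i_{j-1}+1}^{i_j}\mathrm{supp}\,w_i\subseteq\mathrm{supp}\,w'_j$ and $|w_{i_{j-1}+1}|+\cdots+|w_{i_j}|\le|w'_j|$. \end{enumerate}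
   Context: A topological space is Noetherian if every open subset is compact (no separation required). The specialization preordering of a space is: $x\le y$ iff every open neighborhood of $x$ contains $y$ (iff $x$ is in the closure of $\{y\}$). For a space $Y$, $\eta_Y$ maps each $y\in Y$ to the closure of $\{y\}$, i.e. $\{z\in Y\mid z\le y\}$, an irreducible closed subset of $Y$. A bound is an ordinal of the form $\omega^\beta$ or $\omega^\beta+1$ with $\beta\ge0$. A transfinite word $w$ on $X$ is a map from an ordinal $|w|$ (its length) to $X$; the empty word is $\epsilon$. For $F\subseteq X$ and an ordinal $\gamma$, $F^{<\gamma}$ is the set of transfinite words of length $<\gamma$ all of whose letters are in $F$. The concatenation $ww'$ has length $|w|+|w'|$ (ordinal sum), and $AB=\{ww'\mid w\in A,\ w'\in B\}$; the empty product of sets of words is $\{\epsilon\}$. The regular subword topology on $X^{<\alpha}$ is the coarsest topology making all the sets $(F_1^{<\alpha_1}\cdots F_n^{<\alpha_n})\cap X^{<\alpha}$ closed, where $n\in\mathbb N$, $F_1,\dots,F_n$ are closed in $X$ and $\alpha_1,\dots,\alpha_n$ are ordinals. For $w\in X^{<\alpha}$, $\overline w$ denotes the closure of $\{w\}$ in $X^{<\alpha}$. A word $w\in X^{<\alpha}$ is topologically indecomposable if $w\ne\epsilon$ and, for every way of writing $w=uv$ with $v\ne\epsilon$, $w\in\overline v$. The support $\mathrm{supp}\,w$ is the closure in $X$ of the set of letters occurring in $w$. Empty unions are $\emptyset$ and empty sums are $0$. *)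

(* Defs.v *)
From HB Require Import structures.
From mathcomp Require Import all_boot.
From mathcomp Require Import all_order.
From mathcomp Require Import all_classical.
From mathcomp Require Import topology.

Set Implicit Arguments.
Unset Strict Implicit.
Unset Printing Implicit Defensive.

Import Order.TTheory.
Local Open Scope classical_set_scope.
Local Open Scope order_scope.
Local Open Scope quotient_scope.

(** Codes for ordinals: [osup f] denotes the least ordinal strictly above every
    [f i]. Ordinals proper ([Ord] below) are codes modulo mutual [ple]. *)
Inductive preord : Type := osup (I : Type) (f : I -> preord).

Fixpoint ple (x y : preord) {struct x} : Prop :=
  match x, y with
  | osup A f, osup B g => forall i, exists j, ple (f i) (g j)
  end.

Definition plt (x y : preord) : Prop :=
  match y with osup B g => exists j, ple x (g j) end.

Lemma ple_osup I (f : I -> preord) y :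
  ple (osup f) y <-> forall i, plt (f i) y.
Proof. by case: y => J g; split. Qed.

Lemma ple_refl x : ple x x.
Proof. by elim: x => I f IH /= i; exists i. Qed.

Lemma ple_trans y x z : ple x y -> ple y z -> ple x z.
Proof.
elim: x y z => I f IH [J g] [K h] /= xy yz i.
have [j fg] := xy i; have [k gh] := yz j.
by exists k; apply: IH fg gh.
Qed.

Lemma plt_ple_trans x y z : plt x y -> ple y z -> plt x z.
Proof.
case: y z => [J g] [K h] /= [j xg] yz; have [k gh] := yz j.
by exists k; apply: ple_trans xg gh.
Qed.

Lemma ple_plt_trans x y z : ple x y -> plt y z -> plt x z.
Proof. by case: z => K h /= xy [k yh]; exists k; apply: ple_trans xy yh. Qed.

Lemma plt_ple x y : plt x y -> ple x y.
Proof.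
elim: x y => I f IH [J g] /= [j fg] i; exists j.
by apply: IH; apply: (@plt_ple_trans _ (osup f)) fg; exists i; apply: ple_refl.
Qed.

Lemma plt_irr x : ~ plt x x.
Proof.
elim: x => I f IH [i xi]; apply: (IH i).
by apply: (@plt_ple_trans _ (osup f)) xi; exists i; apply: ple_refl.
Qed.

Lemma not_ple x y : ~ ple x y -> plt y x.
Proof.
elim: x y => I f IH [J g] /= /existsNP[i fg]; exists i.
by apply/ple_osup => j; apply: IH => fgj; apply: fg; exists j.
Qed.

HB.instance Definition _ := gen_eqMixin preord.
HB.instance Definition _ := gen_choiceMixin preord.

Definition pequiv (x y : preord) : bool := `[< ple x y /\ ple y x >].

Lemma pequiv_refl : reflexive pequiv.
Proof. by move=> x; apply/asboolP; split; apply: ple_refl. Qed.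

Lemma pequiv_sym : symmetric pequiv.
Proof. by move=> x y; apply/asboolP/asboolP => -[]. Qed.

Lemma pequiv_trans : transitive pequiv.
Proof.
move=> y x z /asboolP[xy yx] /asboolP[yz zy]; apply/asboolP.
by split; [apply: ple_trans xy yz|apply: ple_trans zy yx].
Qed.

Canonical pequiv_equiv := EquivRel pequiv pequiv_refl pequiv_sym pequiv_trans.

Definition Ord := {eq_quot pequiv}.
HB.instance Definition _ : EqQuotient _ pequiv Ord := EqQuotient.on Ord.
HB.instance Definition _ := Choice.on Ord.

Definition leO (a b : Ord) : bool := `[< ple (repr a) (repr b) >].

Lemma leO_refl : reflexive leO.
Proof. by move=> a; apply/asboolP; apply: ple_refl. Qed.

Lemma leO_anti : antisymmetric leO.
Proof.
move=> a b /andP[/asboolP ab /asboolP ba].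
by rewrite -[a]reprK -[b]reprK; apply/eqmodP/asboolP.
Qed.

Lemma leO_trans : transitive leO.
Proof. by move=> b a c /asboolP ? /asboolP ?; apply/asboolP/ple_trans; eauto. Qed.

Lemma leO_total : total leO.
Proof.
move=> a b; apply/orP; have [ab|/not_ple/plt_ple ba] := pselect (ple (repr a) (repr b)).
  by left; apply/asboolP.
by right; apply/asboolP.
Qed.

Fact Ord_display : Order.disp_t. Proof. exact: Order.Disp tt tt. Qed.
HB.instance Definition _ :=
  Order.Le_isPOrder.Build Ord_display Ord leO_refl leO_anti leO_trans.
HB.instance Definition _ := Order.POrder_isTotal.Build Ord_display Ord leO_total.

Lemma repr_piO x : ple x (repr (\pi_Ord x)) /\ ple (repr (\pi_Ord x)) x.
Proof.
have /eqmodP/asboolP[] : \pi_Ord x = \pi_Ord (repr (\pi_Ord x)) by rewrite reprK.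
by [].
Qed.

Lemma leO_pi x y : (\pi_Ord x <= \pi_Ord y) <-> ple x y.
Proof.
have [x1 x2] := repr_piO x; have [y1 y2] := repr_piO y; split.
  by move=> /asboolP h; apply: ple_trans y2; apply: ple_trans h.
by move=> h; apply/asboolP; apply: ple_trans y1; apply: ple_trans h.
Qed.

Lemma ltO_pi x y : (\pi_Ord x < \pi_Ord y) <-> plt x y.
Proof.
rewrite ltNge; split=> [/negP h|h].
  by apply: not_ple => /leO_pi.
by apply/negP => /leO_pi yx; apply: (@plt_irr x); apply: plt_ple_trans yx.
Qed.

Definition pzero : preord := osup (fun e : Empty_set => match e with end).
Definition pone : preord := osup (fun _ : unit => pzero).

(** x + y is the least ordinal strictly above all x' < x and all x + y',
    y' < y. *)
Fixpoint padd (x y : preord) {struct y} : preord :=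
  match x, y with
  | osup A f, osup B g =>
      osup (fun k : A + B =>
        match k with inl i => f i | inr j => padd x (g j) end)
  end.

Definition pmuln (x : preord) (n : nat) : preord :=
  iter n (fun y => padd y x) pzero.

(** omega^y is the least ordinal strictly above 0 and all omega^y' * n,
    y' < y, n < omega; that is, omega^0 = 1, omega^(b+1) = omega^b * omega,
    and omega^y is the supremum of the omega^y', y' < y, when y is limit. *)
Fixpoint pomega (y : preord) : preord :=
  match y with
  | osup B g =>
      osup (fun k : option (B * nat) =>
        match k with
        | None => pzero
        | Some (j, n) => pmuln (pomega (g j)) n
        end)
  end.

Definition zeroO : Ord := \pi_Ord pzero.
Definition oneO : Ord := \pi_Ord pone.
Definition addO (a b : Ord) : Ord := \pi_Ord (padd (repr a) (repr b)).
Definition omegaO (b : Ord) : Ord := \pi_Ord (pomega (repr b)).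

Definition is_bound (alpha : Ord) : Prop :=
  exists beta : Ord, alpha = omegaO beta \/ alpha = addO (omegaO beta) oneO.

Lemma plt_padd x y z :
  plt z (padd x y) <-> plt z x \/ exists2 y', plt y' y & ple z (padd x y').
Proof.
have pinr x' J (g : J -> preord) j :
    plt (padd x' (g j)) (padd x' (osup g)).
  by case: x' => I f; exists (inr j); apply: ple_refl.
have mono : forall y1 x1 y2, ple y1 y2 -> ple (padd x1 y1) (padd x1 y2).
  elim=> J g IH [I f] [K h] le12; apply/ple_osup => -[i|j].
    by exists (inl i); apply: ple_refl.
  have [k gh] := le12 j.
  by exists (inr k); apply: (IH j _ (h k)).
split.
- case: x y => [I f] [J g] [[i|j]] zk.
    by left; exists i.
  by right; exists (g j) => //; exists j; apply: ple_refl.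
- case: y x => [J g] [I f] [[i zi]|[y' [j y'g] zy']].
    by exists (inl i).
  by exists (inr j); apply: ple_trans zy' _; apply: mono.
Qed.

Lemma padd_mono x1 x2 y1 y2 :
  ple x1 x2 -> ple y1 y2 -> ple (padd x1 y1) (padd x2 y2).
Proof.
elim: y1 x1 x2 y2 => J g IH [I f] x2 y2 lex ley; apply/ple_osup => -[i|j].
  apply/plt_padd; left; apply: plt_ple_trans lex.
  by exists i; apply: ple_refl.
apply/plt_padd; right; exists (g j); last exact: IH (ple_refl _).
by apply: plt_ple_trans ley; exists j; apply: ple_refl.
Qed.

Lemma addO_pi x y : addO (\pi_Ord x) (\pi_Ord y) = \pi_Ord (padd x y).
Proof.
have [x1 x2] := repr_piO x; have [y1 y2] := repr_piO y.
by apply/eqmodP/asboolP; split; apply: padd_mono.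
Qed.

Lemma lt_addO (a b c : Ord) :
  c < addO a b <-> c < a \/ exists2 b', b' < b & c <= addO a b'.
Proof.
rewrite -[a]reprK -[b]reprK -[c]reprK; move: (repr a) (repr b) (repr c) => x y z.
rewrite addO_pi !ltO_pi plt_padd; split=> -[zx|]; [by left| |by left|].
  move=> [y' y'y zy']; right; exists (\pi_Ord y'); first exact/ltO_pi.
  by rewrite addO_pi; apply/leO_pi.
move=> [b' b'y]; rewrite -[b']reprK addO_pi => /leO_pi zb'.
by right; exists (repr b') => //; apply/ltO_pi; rewrite reprK.
Qed.

Lemma pmuln_mono x y n : ple x y -> ple (pmuln x n) (pmuln y n).
Proof.
by move=> h; elim: n => [|n ih]; [exact: ple_refl|exact: padd_mono].
Qed.

Lemma pomega_mono y1 y2 : ple y1 y2 -> ple (pomega y1) (pomega y2).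
Proof.
elim: y1 y2 => J g IH [K h] le12; apply/ple_osup => -[[j n]|].
  have [k gh] := le12 j.
  by exists (Some (k, n)); apply: pmuln_mono; apply: (IH j (h k) gh).
by exists None; apply: ple_refl.
Qed.

Lemma plt_pomega z y :
  plt z (pomega y) <->
  ple z pzero \/ exists y' n, plt y' y /\ ple z (pmuln (pomega y') n).
Proof.
split.
  case: y => J g [[[j n]|] h]; last by left.
  by right; exists (g j), n; split=> //; exists j; apply: ple_refl.
case: y => J g [h|[y' [n [[j h1] h2]]]]; first by exists None.
exists (Some (j, n)); apply: ple_trans h2 _.
by apply: pmuln_mono; apply: pomega_mono.
Qed.

Definition mulnO (a : Ord) (n : nat) : Ord := iter n (fun b => addO b a) zeroO.

Lemma mulnO_pi x n : mulnO (\pi_Ord x) n = \pi_Ord (pmuln x n).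
Proof. by elim: n => //= n ->; apply: addO_pi. Qed.

Lemma omegaO_pi y : omegaO (\pi_Ord y) = \pi_Ord (pomega y).
Proof.
have [h1 h2] := repr_piO y.
by apply/le_anti/andP; split; apply/leO_pi; apply: pomega_mono.
Qed.

Lemma lt_omegaO (b c : Ord) :
  c < omegaO b <->
  c = zeroO \/ exists b' n, b' < b /\ c <= mulnO (omegaO b') n.
Proof.
rewrite -[b]reprK -[c]reprK; move: (repr b) (repr c) => y z.
rewrite omegaO_pi ltO_pi plt_pomega; split=> -[h|[b' [n [h1 h2]]]].
- left; apply: le_anti; apply/andP; split; apply/leO_pi => //.
  by case: (z) => ? ? [].
- right; exists (\pi_Ord b'), n; split; first exact/ltO_pi.
  by rewrite omegaO_pi mulnO_pi; apply/leO_pi.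
- by left; apply/leO_pi; rewrite h.
- right; exists (repr b'), n; split; first by apply/ltO_pi; rewrite reprK.
  by apply/leO_pi; rewrite -mulnO_pi -omegaO_pi reprK.
Qed.

Lemma wf_ltO : well_founded (fun a b : Ord => a < b).
Proof.
suff H (x y : preord) : ple y x -> Acc (fun a b : Ord => a < b) (\pi_Ord y).
  by move=> a; rewrite -[a]reprK; apply: H (ple_refl _).
elim: x y => I f IH y lex; constructor=> b; rewrite -[b]reprK => /ltO_pi ltb.
by have [i] := plt_ple_trans ltb lex; apply: IH.
Qed.

Lemma addO_ge (a b c : Ord) : a <= c -> c < addO a b ->
  exists2 d, d < b & c = addO a d.
Proof.
move=> ac; elim/(well_founded_ind wf_ltO): b => b IH /lt_addO[|[d db]].
  by rewrite ltNge ac.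
rewrite le_eqVlt => /predU1P[->|]; first by exists d.
by move=> /(IH _ db)[e ed ->]; exists e => //; apply: lt_trans db.
Qed.

Definition initseg (a : Ord) : Type := {i : Ord | i < a}.

Definition word (X : Type) : Type := {l : Ord & initseg l -> X}.

Section Words.
Variable X : Type.
Implicit Types (u v w : word X) (A B : set (word X)).

Definition wlen w : Ord := projT1 w.
Definition letter w : initseg (wlen w) -> X := projT2 w.

Lemma not_lt_zeroO (i : Ord) : i < zeroO -> False.
Proof. by rewrite -[i]reprK => /ltO_pi[]. Qed.

Definition wnil : word X :=
  existT _ zeroO (fun i => False_rect X (not_lt_zeroO (valP i))).

Lemma addO_split_subproof (a b : Ord) (i : initseg (addO a b)) :
  ~ val i < a -> {d : Ord | d < b /\ val i = addO a d}.
Proof.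
case: i => i iab /= ia; apply: cid.
have ai : a <= i by rewrite leNgt; apply/negP.
by have [d db ->] := addO_ge ai iab; exists d.
Qed.

Definition addO_split (a b : Ord) (i : initseg (addO a b)) :
  {j : initseg a | val i = val j} + {k : initseg b | val i = addO a (val k)} :=
  match pselect (val i < a) with
  | left ia => inl (exist (fun j : initseg a => val i = val j) (exist (fun j : Ord => j < a) (val i) ia) erefl)
  | right nia =>
      let: exist d (conj db e) := addO_split_subproof nia in
      inr (exist (fun k : initseg b => val i = addO a (val k)) (exist (fun k : Ord => k < b) d db) e)
  end.

Definition wcat u v : word X :=
  existT _ (addO (wlen u) (wlen v))
    (fun i => match addO_split i with
              | inl (exist j _) => letter j
              | inr (exist k _) => letter k
              end).

Definition wprod A B : set (word X) := [set wcat u v | u in A & v in B].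

Definition wpow (F : set X) (gamma : Ord) : set (word X) :=
  [set w | wlen w < gamma /\ forall i, F (@letter w i)].

Record wordlt (alpha : Ord) := WordLt {
  word_of :> word X;
  wlen_lt : wlen word_of < alpha
}.

HB.instance Definition _ alpha := gen_eqMixin (wordlt alpha).
HB.instance Definition _ alpha := gen_choiceMixin (wordlt alpha).

End Words.

Section RegularSubwordTopology.
Variables (X : topologicalType) (alpha : Ord).

(* The coarsest topology making a family of sets closed is the one generated
   by their complements. *)
Definition rsubword_subbase : set (set (wordlt X alpha)) :=
  [set U | exists (n : nat) (F : 'I_n -> set X) (a : 'I_n -> Ord),
     (forall i, closed (F i)) /\
     U = ~` [set w : wordlt X alpha |
              (\big[@wprod X/[set wnil X]]_(i < n) wpow (F i) (a i)) w]].

HB.instance Definition _ :=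
  isSubBaseTopological.Build (wordlt X alpha) rsubword_subbase id.

End RegularSubwordTopology.

Definition noetherian (X : topologicalType) : Prop :=
  forall U : set X, open U -> compact U.

Definition specle (Y : topologicalType) (x y : Y) : Prop :=
  forall U : set Y, open U -> U x -> U y.

Definition eta_map (Y : topologicalType) (y : Y) : set Y := closure [set y].

Definition supp (X : topologicalType) (w : word X) : set X :=
  closure (range (@letter X w)).

(** The closure in X^{<alpha}, viewed as a set of words so that closures can be
    concatenated by [wprod]. *)
Definition wclosure (X : topologicalType) (alpha : Ord) (w : wordlt X alpha) :
    set (word X) :=
  @word_of X alpha @` closure [set w].

(** A suffix of a word of length < alpha has length < alpha, hence letting [v]
    range over [wordlt X alpha] loses no decomposition of [w]. *)
Definition top_indecomposable (X : topologicalType) (alpha : Ord)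
    (w : wordlt X alpha) : Prop :=
  word_of w <> wnil X /\
  forall (u : word X) (v : wordlt X alpha),
    word_of w = wcat u v -> word_of v <> wnil X -> closure [set v] w.

(** As above, the factors of [w] have length < alpha automatically. *)
Definition top_factorization (X : topologicalType) (alpha : Ord)
    (w : wordlt X alpha) (n : nat) (ws : 'I_n -> wordlt X alpha) : Prop :=
  (forall i, top_indecomposable (ws i)) /\
  word_of w = \big[@wcat X/wnil X]_(i < n) word_of (ws i).

(* Main.v *)
(* Write [u <= w] when [u] lies in every product of sets [F^{<a}] (F closed)
   that contains [w]; inside X^{<alpha} this is membership in the closure of
   {w}. A word [w] is topologically indecomposable iff each nonempty suffix has
   the length and the support of [w]: a product containing such a [w] has a
   factor containing a suffix of [w], and that factor contains all of
   (supp w)^{<|w|+1}. A nonempty word has such a suffix (minimize the length of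
   a nonempty suffix, then, X being Noetherian, its support), so factorizations
   exist by induction on the length. Cutting a product at the position where it
   cuts [uv] shows that [<=] is compatible with concatenation, hence closures
   multiply. Finally, [w_1 ... w_m] in a product of n factors: each [w_i] is
   charged to the last factor it meets, which is large enough for all of [w_i]. *)
Require Import Defs.
From HB Require Import structures.
From mathcomp Require Import all_boot.
From mathcomp Require Import all_order.
From mathcomp Require Import finmap all_classical.
From mathcomp Require Import topology.
Set Implicit Arguments.
Unset Strict Implicit.
Unset Printing Implicit Defensive.
Import Order.TTheory.
Local Open Scope order_scope.
Local Open Scope classical_set_scope.

Implicit Types (a b c d : Ord).

(** * Ordinal addition *)

Lemma le0O a : zeroO <= a.
Proof. by rewrite leNgt; apply/negP => /not_lt_zeroO. Qed.

(** Extensionality of ordinals: combined with [lt_addO], it reduces identities such as associativity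
    to well-founded induction on the rightmost summand. *)
Lemma eq_ltO a b : (forall c, c < a <-> c < b) -> a = b.
Proof.
move=> ab; apply/le_anti; rewrite !leNgt; apply/andP; split; apply/negP.
  by move/ab; rewrite ltxx.
by move/(ab a); rewrite ltxx.
Qed.

Lemma leO_add a a' b b' : a <= a' -> b <= b' -> addO a b <= addO a' b'.
Proof.
move=> /asboolP aa' /asboolP bb'.
by apply/leO_pi; apply: padd_mono.
Qed.

Lemma addO0 : right_id zeroO addO.
Proof.
move=> a; apply: eq_ltO => c; rewrite lt_addO; split=> [[//|[? /not_lt_zeroO//]]|].
by left.
Qed.

Lemma add0O : left_id zeroO addO.
Proof.
move=> b; elim/(well_founded_ind wf_ltO): b => b IH.
apply: eq_ltO => c; rewrite lt_addO; split.
  by move=> [/not_lt_zeroO//|[b' b'b]]; rewrite IH// => /le_lt_trans; apply.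
by move=> cb; right; exists c => //; rewrite IH.
Qed.

Lemma addOA : associative addO.
Proof.
move=> a b c; elim/(well_founded_ind wf_ltO): c => c IH.
apply: eq_ltO => x; rewrite !lt_addO; split.
  move=> [xa|[d /lt_addO[db|[c' c'c dc']] xd]].
  - by left; left.
  - by left; right; exists d.
  - right; exists c' => //; rewrite -IH//; apply: le_trans xd _.
    exact: leO_add.
move=> [[xa|[d db xd]]|[c' c'c]].
- by left.
- by right; exists d => //; apply/lt_addO; left.
- rewrite -IH// => xc'; right; exists (addO b c') => //.
  by apply/lt_addO; right; exists c'.
Qed.

HB.instance Definition _ :=
  Monoid.isLaw.Build Ord zeroO addO addOA add0O addO0.

Lemma leO_addl a b : a <= addO a b.
Proof. by rewrite -{1}[a]addO0; apply: leO_add (le0O b). Qed.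

Lemma leO_addr a b : b <= addO a b.
Proof. by rewrite -{1}[b]add0O; apply: leO_add (le0O a) _. Qed.

Lemma ltO_add2l a b b' : (addO a b < addO a b') = (b < b').
Proof.
apply/idP/idP => [|bb']; last by apply/lt_addO; right; exists b.
by apply: contraTT; rewrite -!leNgt => /(leO_add (lexx a)).
Qed.

Lemma addOI a : injective (addO a).
Proof.
move=> b b' e; case: (ltgtP b b') => //; rewrite -(ltO_add2l a) e ltxx//.
Qed.

Lemma lt_addO1 a c : c < addO a oneO <-> c <= a.
Proof.
have o1 : zeroO < oneO by apply/ltO_pi; exists tt; apply: ple_refl.
split=> [/lt_addO[/ltW//|[b b1]]|ca].
  suff -> : b = zeroO by rewrite addO0.
  apply/le_anti; rewrite le0O andbT; move: b1.
  by rewrite -[b]reprK => /ltO_pi[_ /leO_pi].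
by apply: le_lt_trans ca _; rewrite -{1}[a]addO0 ltO_add2l.
Qed.

Lemma leO_subP a c : a <= c -> exists d, c = addO a d.
Proof.
move=> ac.
(* Any right summand that puts the sum above [c] would do; [c + 1] is one, and [addO_ge] then
   extracts the difference. *)
have h : c < addO a (addO c oneO).
  by apply: (@lt_le_trans _ _ (addO c oneO)); [exact/lt_addO1|exact: leO_addr].
by have [d _ ->] := addO_ge ac h; exists d.
Qed.

(** * The monoid of transfinite words *)

Section WordMonoid.
Variable X : Type.
Implicit Types (u v w x y z : word X) (A B : set (word X)).

(** A relation rather than a function on [initseg (wlen w)]: words whose lengths are only provably
    equal can be compared letter by letter without casts. *)
Definition at_ w (i : Ord) (t : X) : Prop :=
  exists h : i < wlen w, letter (exist _ i h : initseg (wlen w)) = t.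

Lemma at_lt w i t : at_ w i t -> i < wlen w. Proof. by case. Qed.

Lemma lt_at w i : i < wlen w -> exists t, at_ w i t.
Proof. by move=> h; exists (letter (exist _ i h : initseg (wlen w))); exists h. Qed.

Lemma at_letter w (i : initseg (wlen w)) : at_ w (val i) (letter i).
Proof. by case: i => i h; exists h. Qed.

Lemma at_fun w i t t' : at_ w i t -> at_ w i t' -> t = t'.
Proof. by move=> [h <-] [h' <-]; congr letter; apply: eq_exist. Qed.

Lemma word_ext u v : (forall i t, at_ u i t <-> at_ v i t) -> u = v.
Proof.
case: u v => [a f] [b g] uv.
have ab : a = b.
  apply: eq_ltO => c; split=> h.
    by have [t /uv/at_lt] := @lt_at (existT _ a f) c h.
  by have [t /uv/at_lt] := @lt_at (existT _ b g) c h.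
subst b; congr existT; apply/funext => i.
have /uv fi := @at_letter (existT _ a f) i.
exact: at_fun fi (@at_letter (existT _ a g) i).
Qed.

Lemma at_wcat u v i t :
  at_ (wcat u v) i t <-> at_ u i t \/ exists2 j, i = addO (wlen u) j & at_ v j t.
Proof.
have key (x : X) : at_ (wcat u v) i x ->
    at_ u i x \/ exists2 j, i = addO (wlen u) j & at_ v j x.
  move=> [h <-]; rewrite /letter/=; case: addO_split => -[j e].
    by left; rewrite [i]e; apply: at_letter.
  by right; exists (val j) => //; apply: at_letter.
split=> [/key//|uv].
(* For the converse, the length alone gives some letter [x] at [i]; [key] locates it, and it must be
   [t], because a position in [u] is never of the form [|u| + j]. *)
have [x uvx] : exists x : X, at_ (wcat u v) i x.
  apply: lt_at; apply/lt_addO; case: uv => [/at_lt|[j -> /at_lt jv]].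
    by left.
  by right; exists j.
suff <- : x = t by [].
case: (key _ uvx) uv => [ux|[j -> vx]] [ut|[k]].
- exact: at_fun ux ut.
- by move=> ik; move: (at_lt ux); rewrite ik ltNge leO_addl.
- by move: (at_lt ut); rewrite ltNge leO_addl.
- by move=> /addOI <-; apply: at_fun vx.
Qed.

Lemma at_wcatl u v i t : i < wlen u -> at_ (wcat u v) i t <-> at_ u i t.
Proof.
move=> iu; rewrite at_wcat; split=> [[//|[j e _]]|]; last by left.
by move: iu; rewrite e ltNge leO_addl.
Qed.

Lemma at_wcatr u v j t : at_ (wcat u v) (addO (wlen u) j) t <-> at_ v j t.
Proof.
rewrite at_wcat; split=> [[/at_lt|[k /addOI->//]]|]; last by right; exists j.
by rewrite ltNge leO_addl.
Qed.

Lemma wlen0 w : wlen w = zeroO -> w = wnil X.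
Proof.
move=> w0; apply: word_ext => i t; split=> /at_lt.
  by rewrite w0 => /not_lt_zeroO.
by move/not_lt_zeroO.
Qed.

Lemma at_nil i t : ~ at_ (wnil X) i t.
Proof. by move/at_lt/not_lt_zeroO. Qed.

Lemma wcat0w : left_id (wnil X) (@wcat X).
Proof.
move=> w; apply: word_ext => i t; rewrite -{1}[i]add0O.
exact: (at_wcatr (wnil X)).
Qed.

Lemma wcatw0 : right_id (wnil X) (@wcat X).
Proof.
move=> w; apply: word_ext => i t; rewrite at_wcat; split; last by left.
by move=> [//|[j _ /at_nil]].
Qed.

Lemma wcatA : associative (@wcat X).
Proof.
move=> u v w; apply: word_ext => i t; rewrite !at_wcat; split.
  move=> [|[j -> /at_wcat[vj|[k -> wk]]]]; first by left; left.
    by left; right; exists j.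
  by right; exists k => //; rewrite addOA.
move=> [[|[j -> vj]]|[k -> wk]]; first by left.
  by right; exists j => //; apply/at_wcat; left.
right; exists (addO (wlen v) k); first by rewrite addOA.
by apply/at_wcatr.
Qed.

HB.instance Definition _ :=
  Monoid.isLaw.Build (word X) (wnil X) (@wcat X) wcatA wcat0w wcatw0.

Lemma wcatI u : injective (wcat u).
Proof.
by move=> v w e; apply: word_ext => j t; rewrite -(at_wcatr u) e at_wcatr.
Qed.

Lemma wcat_eq0 u v : wcat u v = wnil X -> u = wnil X /\ v = wnil X.
Proof.
move=> e; have l : addO (wlen u) (wlen v) = zeroO by rewrite -[RHS]/(wlen (wnil X)) -e.
by split; apply/wlen0/le_anti; rewrite le0O andbT -l ?leO_addl// leO_addr.
Qed.

Lemma wlen_cat_lt u v : v <> wnil X -> wlen u < wlen (wcat u v).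
Proof.
move=> v0; rewrite -[ltLHS]addO0 ltO_add2l lt_neqAle le0O andbT.
by apply/eqP => /esym/wlen0.
Qed.

(** Levi's lemma. When [|x| <= |u|], the left difference [|u| = |x| + d] yields [z], the word of
    length [d] that reads [u] from position [|x|] on; left cancellation then gives the equation for
    [y]. *)
Lemma wcat_levi u v x y : wcat u v = wcat x y ->
  (exists2 z, u = wcat x z & y = wcat z v) \/
  (exists2 z, x = wcat u z & v = wcat z y).
Proof.
wlog xu : u v x y / wlen x <= wlen u => [H e|e].
  by case/orP: (le_total (wlen x) (wlen u)) => /H;
    [move/(_ _ _ e)|move/(_ _ _ (esym e)) => -[]]; by [left|right|auto].
left; have [d ud] := leO_subP xu.
have lt (k : initseg d) : addO (wlen x) (val k) < wlen u.
  by rewrite ud ltO_add2l; case: k.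
pose up (k : initseg d) : initseg (wlen u) := exist (fun j => j < wlen u) _ (lt k).
pose z : word X := existT _ d (fun k => letter (up k)).
have uE : u = wcat x z.
  apply: word_ext => i t; rewrite at_wcat; split.
    move=> ui; have := iffRL (at_wcat u v i t) (or_introl ui).
    rewrite e at_wcat => -[xi|[j ij _]]; [by left|right].
    exists j => //; have jd : j < d by rewrite -(ltO_add2l (wlen x)) -ud -ij (at_lt ui).
    exists jd; have := @at_letter u (up (exist _ j jd)) => /=.
    by rewrite -ij => /(at_fun ui) ->.
  move=> [xi|[j -> [/= h <-]]]; last exact: (@at_letter u (up (exist _ j h))).
  by apply/(at_wcatl v); [exact: lt_le_trans (at_lt xi) xu|rewrite e at_wcat; left].
exists z => //; apply: (@wcatI x).
by rewrite -e wcatA -uE.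
Qed.

Lemma wpow_nil F a : zeroO < a -> wpow F a (wnil X).
Proof. by move=> a0; split=> // -[i ii]; have := not_lt_zeroO ii. Qed.

Lemma wpowP F a w : wpow F a w <-> wlen w < a /\ forall i t, at_ w i t -> F t.
Proof.
split=> -[wa h]; split=> // i; first by move=> t [hi <-].
exact: h (at_letter i).
Qed.

Lemma wpow_cat F a b u v :
  wpow F (addO a oneO) u -> wpow F (addO b oneO) v ->
  wpow F (addO (addO a b) oneO) (wcat u v).
Proof.
move=> /wpowP[/lt_addO1 ua uF] /wpowP[/lt_addO1 vb vF]; apply/wpowP; split.
  exact/lt_addO1/leO_add.
by move=> i t /at_wcat[/uF|[j _ /vF]].
Qed.

End WordMonoid.

(** * Products of sets [F^{<a}], their preorder, and indecomposable words *)

Section RegularProducts.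
Variable X : topologicalType.
Implicit Types (u v w x y z : word X) (F : set X) (P : set (word X)).

(** The subbasic closed sets before intersection with [X^{<alpha}], in inductive form so that
    factors can be peeled off from the left; [regprod_big] and [regprod_exists_big] relate them to
    the indexed products. *)
Inductive regprod : set (word X) -> Prop :=
| regprod0 : regprod [set wnil X]
| regprodS F a P : closed F -> regprod P -> regprod (wprod (wpow F a) P).

Lemma regprod_big n (F : 'I_n -> set X) (a : 'I_n -> Ord) :
  (forall k : 'I_n, closed (F k)) ->
  regprod (\big[@wprod X/[set wnil X]]_(i < n) wpow (F i) (a i)).
Proof.
elim: n F a => [|n IH] F a cF; first by rewrite big_ord0; apply: regprod0.
rewrite big_ord_recl; apply: regprodS => //.
by apply: (IH (fun i => F (lift ord0 i)) (fun i => a (lift ord0 i))).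
Qed.

Lemma regprod_exists_big P : regprod P ->
  exists n (F : 'I_n -> set X) (a : 'I_n -> Ord),
    (forall k : 'I_n, closed (F k)) /\
    P = \big[@wprod X/[set wnil X]]_(i < n) wpow (F i) (a i).
Proof.
elim=> [|F0 a0 {}P cF0 _ [n [F [a [cF ->]]]]].
  by exists 0%N, (fun=> set0), (fun=> zeroO); split=> [[]//|]; rewrite big_ord0.
exists n.+1, (fun i => if unlift ord0 i is Some j then F j else F0).
exists (fun i => if unlift ord0 i is Some j then a j else a0); split.
  by move=> i; case: unliftP.
rewrite big_ord_recl unlift_none; congr wprod.
by apply: eq_bigr => i _; rewrite liftK.
Qed.

Lemma regprod_wpow F a : closed F -> regprod (wpow F a).
Proof.
move=> cF; suff <- : wprod (wpow F a) [set wnil X] = wpow F a.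
  by apply: regprodS => //; apply: regprod0.
rewrite eqEsubset; split=> w; first by move=> [u uF [_ -> <-]]; rewrite wcatw0.
by move=> wF; exists w => //; exists (wnil X) => //; rewrite wcatw0.
Qed.

(** No [alpha] occurs here: the preorder lives on all words, and [closure_wle] relates it to
    closures in each [X^{<alpha}]. *)
Definition wle u w := forall P, regprod P -> P w -> P u.

Lemma wle_refl w : wle w w. Proof. by []. Qed.

(* If [uv] belongs to a product, the factor of the product in which the cut
   between [u] and [v] occurs is split according to the lengths of the two
   pieces of the word. *)
Lemma regprod_split P u v : regprod P -> P (wcat u v) ->
  exists P1 P2, [/\ regprod P1, regprod P2, P1 u, P2 v & wprod P1 P2 `<=` P].
Proof.
move=> rP; elim: rP u v => {P} [|F a P cF rP IH] u v.
  move=> /wcat_eq0[-> ->]; exists [set wnil X], [set wnil X].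
  split; [exact: regprod0|exact: regprod0| | |] => //.
  by move=> _ [_ -> [_ -> <-]]; rewrite wcatw0.
move=> [x Fx [r Pr]] /esym /wcat_levi[[z uE rE]|[z xE vE]].
  have [|P1 [P2 [rP1 rP2 P1z P2v P12]]] := IH z v; first by rewrite -rE.
  exists (wprod (wpow F a) P1), P2; split=> //; first exact: regprodS.
    by rewrite uE; exists x => //; exists z.
  move=> _ [_ [x' Fx' [z' P1z' <-]] [v' P2v' <-]]; exists x' => //.
  by exists (wcat z' v'); [apply: P12; exists z' => //; exists v'|rewrite wcatA].
move: Fx => /wpowP[xa xF].
exists (wpow F (addO (wlen u) oneO)).
exists (wprod (wpow F (addO (wlen z) oneO)) P); split.
- exact: regprod_wpow.
- exact: regprodS.
- apply/wpowP; split=> [|i t ui]; first exact/lt_addO1.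
  by apply: (xF i t); rewrite xE at_wcat; left.
- rewrite vE; exists z; last by exists r.
  apply/wpowP; split=> [|i t zi]; first exact/lt_addO1.
  by apply: (xF (addO (wlen u) i) t); rewrite xE at_wcatr.
- move=> _ [u' Fu' [_ [z' Fz' [r' Pr' <-]] <-]]; exists (wcat u' z').
    have /wpowP[/lt_addO1 l F'] := wpow_cat Fu' Fz'; apply/wpowP; split=> //.
    by apply: le_lt_trans l _; rewrite xE in xa.
  by exists r' => //; rewrite wcatA.
Qed.

(** After [regprod_split] each half lies in its own regular product and can be lowered
    independently. *)
Lemma wle_cat u u' v v' : wle u u' -> wle v v' -> wle (wcat u v) (wcat u' v').
Proof.
move=> uu' vv' P rP /(regprod_split rP)[P1 [P2 [rP1 rP2 P1u P2v]]]; apply.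
by exists u; [exact: uu'|exists v => //; exact: vv'].
Qed.

Lemma at_supp w i t : at_ w i t -> supp w t.
Proof. by move=> [h <-]; apply: subset_closure; eexists. Qed.

Lemma closed_supp w : closed (supp w).
Proof. exact: closed_closure. Qed.

Lemma supp_sub w F : closed F -> (forall i t, at_ w i t -> F t) -> supp w `<=` F.
Proof.
move=> cF wF; rewrite [F](iffLR (closure_id F))//.
by apply: closureS => _ [i _ <-]; apply: wF (at_letter i).
Qed.

Lemma wpow_supp w : wpow (supp w) (addO (wlen w) oneO) w.
Proof. by apply/wpowP; split; [exact/lt_addO1|move=> i t; apply: at_supp]. Qed.

(** The set on the right is itself a regular product containing [w]. Hence both length and support
    are monotone for [wle]. *)
Lemma wle_wpow_supp u w : wle u w -> wpow (supp w) (addO (wlen w) oneO) u.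
Proof.
by apply; [apply: regprod_wpow; apply: closed_supp|apply: wpow_supp].
Qed.

Lemma wle_len u w : wle u w -> wlen u <= wlen w.
Proof. by move=> /wle_wpow_supp/wpowP[/lt_addO1]. Qed.

Lemma wle_supp u w : wle u w -> supp u `<=` supp w.
Proof.
move=> /wle_wpow_supp/wpowP[_ h]; apply: supp_sub h; exact: closed_supp.
Qed.

Lemma supp_catr u v : supp v `<=` supp (wcat u v).
Proof.
apply: supp_sub; first exact: closed_supp.
move=> i t vi; apply: (@at_supp _ (addO (wlen u) i)).
by rewrite at_wcatr.
Qed.

(** Indecomposability in terms of lengths and supports only. The reverse comparisons hold for every
    suffix, and [indecP] recovers the formulation by the preorder. *)
Definition indec w : Prop :=
  w <> wnil X /\ forall u v, w = wcat u v -> v <> wnil X ->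
    wlen w <= wlen v /\ supp w `<=` supp v.

(* The last factor of a product that meets a nonempty suffix [v] of [w] meets
   it in a suffix of [w]; that factor already contains all of
   [(supp w)^{<|w|+1}]. *)
Lemma indec_regprod w u v P y : indec w -> w = wcat u v -> v <> wnil X ->
  regprod P -> P v -> wpow (supp w) (addO (wlen w) oneO) y -> P y.
Proof.
move=> [w0 iw] + + rP + /wpowP[/lt_addO1 yw yF].
elim: rP u v => {P} [|F a P cF rP IH] u v wE v0; first by [].
move=> [x /wpowP[xa xF] [r Pr vE]].
have [r0|r0] := pselect (r = wnil X).
  exists y; last by exists (wnil X); [rewrite -r0|rewrite wcatw0].
  have xv : x = v by rewrite -vE r0 wcatw0.
  have [wv sv] := iw _ _ wE v0.
  apply/wpowP; split; first by rewrite xv in xa; apply: le_lt_trans yw (le_lt_trans wv xa).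
  move=> i t /yF/sv; apply: supp_sub => //; by rewrite -xv.
exists (wnil X); first by apply: wpow_nil; apply: le_lt_trans xa; apply: le0O.
exists y; last exact: wcat0w.
by apply: (IH (wcat u x) r) => //; rewrite -wcatA vE.
Qed.

Lemma indec_wle w u v y : indec w -> w = wcat u v -> v <> wnil X ->
  wpow (supp w) (addO (wlen w) oneO) y -> wle y v.
Proof. by move=> iw wE v0 yw P rP Pv; apply: indec_regprod iw wE v0 rP Pv yw. Qed.

(** The source of the closure formula for one factor: one inclusion holds for every word, the other
    is [indec_wle] with [w] as its own suffix. *)
Lemma indec_wleE w : indec w ->
  [set y | wle y w] = wpow (supp w) (addO (wlen w) oneO).
Proof.
move=> iw; rewrite eqEsubset; split=> y; first exact: wle_wpow_supp.
by apply: (@indec_wle w (wnil X)) => //; [rewrite wcat0w|exact: iw.1].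
Qed.

Lemma indecP w : indec w <->
  w <> wnil X /\ forall u v, w = wcat u v -> v <> wnil X -> wle w v.
Proof.
split=> -[w0 h]; split=> // u v wE v0.
  exact: (indec_wle (conj w0 h) wE v0 (wpow_supp w)).
by have wv := h _ _ wE v0; split; [exact: wle_len|exact: wle_supp].
Qed.

End RegularProducts.

(** * Minimal elements, by well-foundedness and by Noetherianity *)

Lemma wf_min T (len : T -> Ord) (S : set T) : S !=set0 ->
  exists2 v, S v & forall v', S v' -> len v <= len v'.
Proof.
move=> [v0 Sv0]; apply: contrapT => nex.
suff H c : forall v, S v -> len v <> c by exact: H Sv0 erefl.
elim/(well_founded_ind wf_ltO): c => c IH v Sv vc; apply: nex; exists v => // v' Sv'.
by rewrite leNgt; apply/negP; rewrite vc => /IH/(_ _ Sv'); apply.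
Qed.

(** If no [K s] were least, the sets [K s] minus the total intersection [C] would be nonempty, and a
    filter base by the chain condition. The complement of [C] is open, hence compact, so this filter
    clusters at a point outside [C]; but a cluster point lies in every closed [K s], thus in [C]. *)
Lemma noetherian_chain_min (X : topologicalType) T (D : set T) (K : T -> set X) :
  noetherian X -> D !=set0 -> (forall s, D s -> closed (K s)) ->
  (forall s t, D s -> D t -> K s `<=` K t \/ K t `<=` K s) ->
  exists2 s, D s & forall t, D t -> K s `<=` K t.
Proof.
move=> hX D0 cK chain; apply: contrapT => nmin.
pose C := \bigcap_(s in D) K s.
have cC : closed C by apply: closed_bigI.
pose B s := K s `&` ~` C.
have pF : ProperFilter (filter_from D B).
  apply: filter_from_proper.
    apply: filter_from_filter => // s t Ds Dt.
    by case: (chain s t Ds Dt) => st; [exists s|exists t] => // x [Kx Cx];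
      split; split=> //; apply: st.
  move=> s Ds; apply: contrapT => B0; apply: nmin; exists s => // t Dt x Kx.
  apply: contrapT => Ktx; apply: B0; exists x; split=> // Cx; exact: Ktx (Cx t Dt).
have [|p [nCp]] := hX _ (closed_openC cC) _ pF.
  by have [s Ds] := D0; exists s => // x [].
rewrite clusterE => clp; apply: nCp => s Ds.
rewrite [K s](iffLR (closure_id _)); last exact: cK.
by apply: closureS (clp (B s) _); [move=> x []|exists s].
Qed.

Lemma steps_leq (idx : nat -> nat) k n :
  (forall j, (k <= j < n)%N -> (idx j <= idx j.+1)%N) ->
  forall i j, (k <= i)%N -> (i <= j <= n)%N -> (idx i <= idx j)%N.
Proof.
move=> mono i j ki; elim: j => [|j IH]; first by rewrite leqn0 => /andP[/eqP->].
move=> /andP[]; rewrite leq_eqVlt => /predU1P[->//|]; rewrite ltnS => ij jn.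
apply: leq_trans (IH _) (mono _ _); first by rewrite ij ltnW.
by rewrite jn (leq_trans ki ij).
Qed.

Lemma specleE (Y : topologicalType) (x y : Y) : specle x y <-> closure [set y] x.
Proof.
split=> [xy B|cl U oU Ux].
  rewrite nbhsE => -[U [oU Ux] UB]; exists y; split=> //.
  by apply: UB; apply: xy.
by have [_ [-> //]] := cl U (open_nbhs_nbhs (conj oU Ux)).
Qed.

(** * Indecomposable suffixes and lower sets of concatenations *)

Section Words.
Variable X : topologicalType.
Implicit Types (u v w x y z : word X) (F : set X) (P : set (word X)).

(** Suffixes of one word are comparable by Levi's lemma, so their supports form a chain, to which
    [noetherian_chain_min] applies. *)
Lemma indec_suffix w : noetherian X -> w <> wnil X ->
  exists u v, w = wcat u v /\ indec v.
Proof.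
move=> hX w0.
pose S v := v <> wnil X /\ exists u, w = wcat u v.
have [|v0 Sv0 minv0] := wf_min (@wlen X) (S := S).
  by exists w; split=> //; exists (wnil X); rewrite wcat0w.
pose S' v := S v /\ wlen v = wlen v0.
have [| | |v [[vn0 [u wE]] vlen] minv] := noetherian_chain_min (D := S') (K := @supp X) hX.
- by exists v0.
- by move=> v _; apply: closed_supp.
- move=> v v' [[_ [u wE]] _] [[_ [u' wE']] _].
  have /wcat_levi[[z _ ->]|[z _ ->]] : wcat u v = wcat u' v' by rewrite -wE.
    by left; apply: supp_catr.
  by right; apply: supp_catr.
exists u, v; split=> //; split=> // u' v' vE v'0.
(* A suffix of [v] is a suffix of [w], so [v'] competes in both minimizations: its length is
   minimal, being at most that of [v], and then the supports can be compared. *)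
have Sv' : S v' by split=> //; exists (wcat u u'); rewrite -wcatA -vE.
split; first by rewrite vlen minv0.
apply: minv; split=> //; apply/le_anti; rewrite minv0// andbT -vlen vE.
exact: leO_addr.
Qed.

(** From left to right, the product of the sets [(supp f_k)^{<|f_k|+1}] is a regular product that
    contains the concatenation; from right to left, [wle_cat] is iterated. *)
Lemma wle_big n (f : 'I_n -> word X) : (forall k, indec (f k)) ->
  [set v | wle v (\big[@wcat X/wnil X]_(k < n) f k)] =
  \big[@wprod X/[set wnil X]]_(k < n) [set v | wle v (f k)].
Proof.
move=> indf; rewrite eqEsubset; split=> v.
  under [in X in _ -> X]eq_bigr do rewrite indec_wleE//.
  move=> /= vw; apply: vw; first exact: regprod_big (fun=> @closed_supp _ _).
  elim: n f {indf} => [|n IH] f; first by rewrite !big_ord0.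
  rewrite !big_ord_recl; exists (f ord0); first exact: wpow_supp.
  by eexists; [exact: IH (fun k => f (lift ord0 k))|].
elim: n f v {indf} => [|n IH] f v; first by rewrite !big_ord0 => ->.
rewrite !big_ord_recl => -[x xf [y yf <-]]; apply: wle_cat => //.
exact: (IH (fun k => f (lift ord0 k))).
Qed.

(** * Consecutive blocks of a concatenation *)

Section Blocks.
Variable f : nat -> word X.
Local Notation cat p q := (\big[@wcat X/wnil X]_(p <= i < q) f i).

Lemma wlen_big p q : wlen (cat p q) = \big[addO/zeroO]_(p <= i < q) wlen (f i).
Proof. exact: big_morph. Qed.

Lemma at_big p q j (t : X) :
  at_ (cat p q) j t -> exists2 k, (p <= k < q)%N & exists l, at_ (f k) l t.
Proof.
pose K w := forall j, at_ w j t ->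
  exists2 k, (p <= k < q)%N & exists l, at_ (f k) l t.
suff : K (cat p q) by apply.
rewrite big_seq; apply: (big_rec K) => [{}j h|k w + IH {}j]; first by case: (at_nil h).
rewrite mem_index_iota => kpq /at_wcat[fk|[l _ /IH//]].
by exists k => //; exists j.
Qed.

Lemma big_at p q k l (t : X) : (p <= k < q)%N -> at_ (f k) l t ->
  exists j, at_ (cat p q) j t.
Proof.
move=> /andP[pk kq] fk; rewrite (big_cat_nat (n := k))// 1?ltnW//= (big_ltn kq).
by exists (addO (wlen (cat p k)) l); apply/at_wcatr/at_wcat; left.
Qed.

(** The source of the two conditions, on supports and on sums of lengths, in the blockwise
    description of the specialization preordering. *)
Lemma wpow_big F a p q : closed F -> wpow F a (cat p q) <->
  (forall k, (p <= k < q)%N -> supp (f k) `<=` F) /\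
  \big[addO/zeroO]_(p <= i < q) wlen (f i) < a.
Proof.
move=> cF; rewrite wpowP wlen_big; split=> -[h1 h2]; split=> //.
  move=> k kpq; apply: supp_sub => // l t /(big_at kpq)[j]; exact: h2.
by move=> j t /at_big[k /h1 + [l /at_supp]]; apply.
Qed.

(** The index [q] is that of the factor in which [r] starts, or [m] if [r] is empty. The part of
    this factor inside [r] is a nonempty suffix of it, hence dominates the whole factor for [wle],
    and putting the whole factor back keeps the word in [P]. *)
Lemma regprod_cut p m u r P : (p <= m)%N ->
  (forall k, (p <= k < m)%N -> indec (f k)) -> regprod P ->
  cat p m = wcat u r -> P r ->
  exists2 q, (p <= q <= m)%N & (exists x, u = wcat (cat p q) x) /\ P (cat q m).
Proof.
move=> pm + rP; elim/ltn_ind: {pm}(m - p)%N {-2}p pm u r (erefl (m - p)%N).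
move=> d IH {}p; rewrite leq_eqVlt => /predU1P[->|pm] u r dE indf.
  rewrite big_geq// => /esym/wcat_eq0[-> ->] P0; exists m; rewrite ?leqnn//.
  by rewrite big_geq//; split=> //; exists (wnil X); rewrite wcat0w.
rewrite big_ltn// => e Pr.
(* A cut exactly at the end of [f p] goes to the second case, since only a nonempty suffix [z] is
   known to dominate [f p]. *)
have [[z [z0 fz rE]]|[z uE catE]] :
    (exists z, [/\ z <> wnil X, f p = wcat u z & r = wcat z (cat p.+1 m)]) \/
    (exists2 z, u = wcat (f p) z & cat p.+1 m = wcat z r).
- case: (wcat_levi e) => [[z fz rE]|[z uE cE]]; last by right; exists z.
  have [z0|] := pselect (z = wnil X); last by left; exists z.
  by right; exists (wnil X); rewrite ?fz ?rE z0 ?wcatw0 ?wcat0w.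
- exists p; first by rewrite leqnn ltnW.
  split; first by exists u; rewrite big_geq// wcat0w.
  have /indecP[_ ip] : indec (f p) by apply: indf; rewrite leqnn.
  rewrite rE in Pr; rewrite big_ltn//.
  exact: (wle_cat (ip _ _ fz z0) (@wle_refl _ _) rP Pr).
have [||q /andP[pq qm] [[x zE] Pq]] := IH (m - p.+1)%N _ _ pm _ _ erefl _ catE Pr.
- by rewrite dE ltn_sub2l.
- by move=> k /andP[pk km]; apply: indf; rewrite (ltnW pk).
exists q; first by rewrite (ltnW pq).
by split=> //; exists x; rewrite big_ltn// -wcatA -zE.
Qed.

(* Each factor [f i] goes to the block of the last factor of the product that
   it meets: by [regprod_cut], the rest of [f i] may be replaced by the whole
   of [f i]. *)
Lemma big_wprod_blocks (Q : nat -> set X) (a : nat -> Ord) p m k n :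
  (p <= m)%N -> (k <= n)%N ->
  (forall i, (p <= i < m)%N -> indec (f i)) -> (forall j, closed (Q j)) ->
  (\big[@wprod X/[set wnil X]]_(k <= j < n) wpow (Q j) (a j)) (cat p m) <->
  exists idx : nat -> nat, [/\ idx k = p, idx n = m,
    forall j, (k <= j < n)%N -> (idx j <= idx j.+1)%N &
    forall j, (k <= j < n)%N -> wpow (Q j) (a j) (cat (idx j) (idx j.+1))].
Proof.
move=> + kn + cQ.
have rQ l : regprod (\big[@wprod X/[set wnil X]]_(l <= j < n) wpow (Q j) (a j)).
  elim/ltn_ind: {l}(n - l)%N {-2}l (erefl (n - l)%N) => d IH l dE.
  have [nl|ln] := leqP n l; first by rewrite big_geq//; apply: regprod0.
  rewrite big_ltn//; apply: regprodS => //; apply: (IH (n - l.+1)%N) => //.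
  by rewrite -dE ltn_sub2l.
elim/ltn_ind: {kn}(n - k)%N {-2}k kn p (erefl (n - k)%N) => d IH {}k.
rewrite leq_eqVlt => /predU1P[->|kn] p dE pm indf.
  rewrite big_geq//; split=> [/= p0|[idx [<- <-] _ _]]; last by rewrite /= big_geq.
  exists (fun=> p); split=> // [|j /andP[kj]]; last by rewrite ltnNge kj.
  (* The empty product contains only the empty word, which is not a concatenation of one or more
     indecomposable words. *)
  apply/eqP; move: pm; rewrite leq_eqVlt => /orP[//|pm].
  have /indecP[f0 _] : indec (f p) by apply: indf; rewrite leqnn.
  by move: p0; rewrite big_ltn// => /wcat_eq0[/f0].
have lt_d : (n - k.+1 < d)%N by rewrite dE ltn_sub2l.
rewrite big_ltn//; split.
  move=> [u Qu [r Pr /esym e]].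
  have [q /andP[pq qm] [[x uE] Pq]] := regprod_cut pm indf (rQ _) e Pr.
  have /(IH _ lt_d _ kn _ erefl qm)[|idx [idxk idxn mono blk]] := Pq.
    by move=> i /andP[qi im]; apply: indf; rewrite (leq_trans pq).
  (* The induction hypothesis constrains [idx] only from [k.+1] on, where its value is [q]; at [k]
     it is overwritten with [p]. *)
  pose idx' j := if j == k then p else idx j.
  have idxE j : (k < j)%N -> idx' j = idx j.
    by rewrite /idx' => kj; rewrite gtn_eqF.
  have idx'k : idx' k = p by rewrite /idx' eqxx.
  exists idx'; split=> // [|j /andP[]|j /andP[]]; first by rewrite idxE.
    rewrite leq_eqVlt => /predU1P[<- _|kj jn]; first by rewrite idx'k idxE// idxk.
    by rewrite (idxE j)// (idxE j.+1) ?(leqW kj)//; apply: mono; rewrite kj.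
  rewrite leq_eqVlt => /predU1P[<- _|kj jn]; last first.
    by rewrite (idxE j)// (idxE j.+1) ?(leqW kj)//; apply: blk; rewrite kj.
  (* The first block is a prefix of [u], so it inherits the bound on the length and the condition on
     the letters. *)
  rewrite idx'k idxE// idxk; move: Qu; rewrite uE => /wpowP[ua uQ].
  apply/wpowP; split; first exact: le_lt_trans (leO_addl _ _) ua.
  by move=> i t ci; apply: (uQ i t); rewrite at_wcat; left.
move=> [idx [idxk idxn mono blk]].
have kk : (k <= k < n)%N by rewrite leqnn.
have sub j : (k < j < n)%N -> (k <= j < n)%N by case/andP => /ltnW ->.
have pk : (p <= idx k.+1)%N by rewrite -idxk mono.
have km : (idx k.+1 <= m)%N by rewrite -idxn (steps_leq mono)// kn leqnn.
exists (cat p (idx k.+1)); first by rewrite -{1}idxk; apply: blk.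
exists (cat (idx k.+1) m); last by rewrite -big_cat_nat.
apply/(IH _ lt_d _ kn _ erefl km).
  by move=> i /andP[ki im]; apply: indf; rewrite (leq_trans pk).
by exists idx; split=> // j /sub; [apply: mono|apply: blk].
Qed.

End Blocks.
End Words.

(** * Transfer to the regular subword topology *)

Section Closure.
Variables (X : topologicalType) (alpha : Ord).
Implicit Types (v w : wordlt X alpha).

(** The regular products cut down to [X^{<alpha}] are a subbase of closed sets, and membership in
    the closure of a point can be tested on subbasic open neighborhoods. *)
Lemma closure_wle v w : closure [set w] v <-> wle v w.
Proof.
split=> [cl P rP Pw|vw B].
  have [n [F [a [cF PE]]]] := regprod_exists_big rP.
  apply: contrapT => nPv.
  have oP : open (~` [set z : wordlt X alpha | P z]).
    (* Open sets are unions of finite intersections of subbasic sets; here both the union and the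
       intersection have one member. *)
    exists [set ~` [set z : wordlt X alpha | P z]]; last by rewrite bigcup_set1.
    move=> _ ->; exists [fset ~` [set z : wordlt X alpha | P z]]%fset.
      by move=> U; rewrite in_fset1 => /eqP->; rewrite inE; exists n, F, a; rewrite -PE.
    by rewrite set_fset1 bigcap_set1.
  by have [z [-> /(_ Pw)]] := cl _ (open_nbhs_nbhs (conj oP nPv)).
rewrite nbhsE => -[_ [[D fD <-] [A DA Av]] AB]; exists w; split=> //.
apply: AB; exists A => //; have [E subE AE] := fD _ DA.
suff : A w by []; have : A v by []; rewrite -AE => Ev U EU; have := Ev U EU.
have /subE := EU; rewrite inE => -[n [F [a [cF ->]]]].
exact: (fun nPv Pw => nPv (vw _ (regprod_big a cF) Pw)).
Qed.

(** A word below [w] is no longer than [w], so its length is automatically below [alpha]. *)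
Lemma wclosureE w : wclosure w = [set u : word X | wle u w].
Proof.
rewrite eqEsubset; split=> [_ [v /closure_wle vw <-]//|u uw].
by exists (WordLt (le_lt_trans (wle_len uw) (wlen_lt w))) => //; apply/closure_wle.
Qed.

Lemma top_indecomposableP w : top_indecomposable w <-> indec w.
Proof.
rewrite indecP; split=> -[w0 h]; split=> // u v wE v0; last first.
  by apply/closure_wle; apply: h wE v0.
have va : wlen v < alpha.
  by apply: le_lt_trans (wlen_lt w); rewrite wE; apply: leO_addr.
by have /closure_wle := h u (WordLt va) wE v0.
Qed.

(** Factors are split off on the right: removing a nonempty suffix always shortens a word, whereas
    removing a prefix need not, as [1 + omega = omega] shows. *)
Lemma top_factorization_exists w : noetherian X ->
  exists (n : nat) (ws : 'I_n -> wordlt X alpha), top_factorization w ws.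
Proof.
move=> hX.
suff [s sind sE] : exists2 s : seq (wordlt X alpha),
    forall x, x \in s -> indec x &
    word_of w = \big[@wcat X/wnil X]_(x <- s) word_of x.
  exists (size s), (tnth (in_tuple s)); split=> [k|].
    by apply/top_indecomposableP/sind/mem_tnth.
  by rewrite sE big_tnth.
move: {-1}(wlen w) (erefl (wlen w)) => c.
elim/(well_founded_ind wf_ltO): c w => c IH w wc.
have [w0|w0] := pselect (word_of w = wnil X).
  by exists [::] => //; rewrite big_nil.
have [u [v [wE iv]]] := indec_suffix hX w0.
have uw : wlen u < wlen w by rewrite wE; apply: wlen_cat_lt iv.1.
have uwc : wlen u < c by rewrite -wc.
have va : wlen v < alpha.
  by apply: le_lt_trans (wlen_lt w); rewrite wE; apply: leO_addr.
have [s sind /= sE] :=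
  IH _ (uwc) (WordLt (lt_trans uw (wlen_lt w))) erefl.
exists (rcons s (WordLt va)) => [x|]; last by rewrite big_rcons -sE.
by rewrite mem_rcons in_cons => /predU1P[->//|/sind].
Qed.

End Closure.

(** * Specialization in terms of blocks *)

Definition ord_ext T (x0 : T) n (f : 'I_n -> T) (k : nat) : T :=
  if insub k is Some j then f j else x0.

Lemma ord_extE T (x0 : T) n (f : 'I_n -> T) (k : 'I_n) : ord_ext x0 f k = f k.
Proof. by rewrite /ord_ext valK. Qed.

Lemma specle_blocks (X : topologicalType) (alpha : Ord)
    (w w' : wordlt X alpha) (m n : nat)
    (ws : 'I_m -> wordlt X alpha) (ws' : 'I_n -> wordlt X alpha) :
  top_factorization w ws -> top_factorization w' ws' ->
  (specle w w' <->
   exists idx : nat -> nat,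
     idx 0%N = 0%N /\ idx n = m /\
     (forall j, (j < n)%N -> (idx j <= idx j.+1)%N) /\
     forall j : 'I_n,
       \bigcup_(i in [set i : 'I_m | (idx j <= i < idx j.+1)%N])
          supp (ws i) `<=` supp (ws' j) /\
       (\big[addO/zeroO]_(i < m | (idx j <= i < idx j.+1)%N) wlen (ws i)
          <= wlen (ws' j))%O).
Proof.
move=> [iws wE] [iws' w'E].
(* Families indexed by all naturals make blocks into intervals; beyond the range the value is the
   empty word, which never enters a block. *)
pose f := ord_ext (wnil X) (@word_of X alpha \o ws).
pose f' := ord_ext (wnil X) (@word_of X alpha \o ws').
have fE (k : 'I_m) : f k = ws k by exact: ord_extE.
have f'E (k : 'I_n) : f' k = ws' k by exact: ord_extE.
pose a j := addO (wlen (f' j)) oneO.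
(* The closure of [w'] is the product of the closures of its factors, each of them a [wpow]; this is
   the form that [big_wprod_blocks] takes apart. *)
have -> : specle w w' <-> (\big[@wprod X/[set wnil X]]_(0 <= j < n)
    wpow (supp (f' j)) (a j)) (\big[@wcat X/wnil X]_(0 <= i < m) f i).
  rewrite specleE closure_wle w'E -[X in X <-> _]/([set u | wle u _] (word_of w)).
  rewrite wle_big; last by move=> k; apply/top_indecomposableP.
  rewrite wE !big_mkord (eq_bigr _ (fun k _ => fE k)).
  suff <- : \big[@wprod X/[set wnil X]]_(j < n) [set v | wle v (ws' j)] =
      \big[@wprod X/[set wnil X]]_(j < n) wpow (supp (f' j)) (a j) by [].
  apply: eq_bigr => j _; rewrite /a f'E indec_wleE//.
  exact/top_indecomposableP.
rewrite big_wprod_blocks//; first last.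
- by move=> j; apply: closed_supp.
- by move=> i im; have := fE (Ordinal im) => /= ->; apply/top_indecomposableP.
(* The bound [idx j.+1 <= m] lets the interval be read inside ['I_m], and the exponent [|w'_j| + 1]
   turns into the non-strict bound [|w'_j|]. *)
have blkE (idx : nat -> nat) (j : 'I_n) : (idx j.+1 <= m)%N ->
    wpow (supp (f' j)) (a j) (\big[@wcat X/wnil X]_(idx j <= i < idx j.+1) f i) <->
    \bigcup_(i in [set i : 'I_m | (idx j <= i < idx j.+1)%N])
       supp (ws i) `<=` supp (ws' j) /\
    \big[addO/zeroO]_(i < m | (idx j <= i < idx j.+1)%N) wlen (ws i)
       <= wlen (ws' j).
  move=> jm; rewrite wpow_big; last exact: closed_supp.
  rewrite lt_addO1 f'E (big_nat_widen _ _ _ _ _ jm) big_geq_mkord.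
  under eq_bigl do rewrite andTb andbC.
  under eq_bigr do rewrite fE.
  split=> -[h1 ->]; split=> //.
    by move=> t [i /= ij]; rewrite -fE; apply: h1.
  move=> k /andP[jk kj]; have := fE (Ordinal (leq_trans kj jm)) => /= -> t kt.
  by apply: h1; exists (Ordinal (leq_trans kj jm)) => //=; rewrite jk.
have idxm (idx : nat -> nat) : idx n = m ->
    (forall j, (0 <= j < n)%N -> (idx j <= idx j.+1)%N) ->
    forall j : 'I_n, (idx j.+1 <= m)%N.
  by move=> <- mono j; apply: (steps_leq mono); rewrite //= ltn_ord leqnn.
split=> -[idx].
  move=> [idx0 idxn mono blk]; exists idx; do 2!split=> //; split=> [j jn|j].
    exact: mono.
  by apply/(blkE idx j (idxm idx idxn mono j)); apply: blk (ltn_ord j).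
move=> [idx0 [idxn [mono blk]]]; exists idx; split=> // j /= jn.
have {}mono i : (0 <= i < n)%N -> (idx i <= idx i.+1)%N by apply: mono.
exact/(blkE idx (Ordinal jn) (idxm idx idxn mono (Ordinal jn)))/blk.
Qed.

Theorem theorem10p9 (X : topologicalType) (alpha : Ord)
    (hX : noetherian X) (halpha : is_bound alpha) :
  ((forall w : wordlt X alpha,
      exists (n : nat) (ws : 'I_n -> wordlt X alpha), top_factorization w ws) /\
   (forall (w : wordlt X alpha) (n : nat) (ws : 'I_n -> wordlt X alpha),
      top_factorization w ws ->
      eta_map w = closure [set w] /\
      wclosure w = \big[@wprod X/[set wnil X]]_(i < n) wclosure (ws i) /\
      forall i : 'I_n,
        wclosure (ws i) = wpow (supp (ws i)) (addO (wlen (ws i)) oneO))) /\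
  (forall (w w' : wordlt X alpha) (m n : nat)
      (ws : 'I_m -> wordlt X alpha) (ws' : 'I_n -> wordlt X alpha),
      top_factorization w ws -> top_factorization w' ws' ->
      (specle w w' <->
       exists idx : nat -> nat,
         idx 0 = 0 /\ idx n = m /\
         (forall j, j < n -> idx j <= idx j.+1)%N /\
         forall j : 'I_n,
           \bigcup_(i in [set i : 'I_m | (idx j <= i < idx j.+1)%N])
              supp (ws i) `<=` supp (ws' j) /\
           (\big[addO/zeroO]_(i < m | (idx j <= i < idx j.+1)%N) wlen (ws i)
              <= wlen (ws' j))%O)).
Proof.
split; last by move=> *; apply: specle_blocks.
split=> [w|w n ws [iws wE]]; first exact: top_factorization_exists.
have ind i : indec (ws i) by apply/top_indecomposableP.
split=> //; split=> [|i]; last by rewrite wclosureE indec_wleE.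
rewrite wclosureE wE wle_big//.
by apply: eq_bigr => i _; rewrite wclosureE.
Qed.
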